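(* Let $q$ be a positive integer with $q \equiv 4 \pmod 6$. Then $M_q(q-2) \le q+1$.
   Context: Let $A=\{0,1,\dots,q-1\}$ be an alphabet with $q$ elements, regarded as an additive group (not necessarily cyclic). An $(n,q^k,d)$ code over $A$ is a subset $C\subseteq A^n$ (not necessarily linear) with $|C|=q^k$ and minimum Hamming distance $d$. It is a maximum distance separable (MDS) code if $d=n-k+1$. $M_q(k)$ denotes the maximum $n$ for which an $(n,q^k,n-k+1)$ MDS code over $A$ exists. *)

(* Defs.v *)
From mathcomp Require Import all_boot all_algebra.

Set Implicit Arguments.
Unset Strict Implicit.
Unset Printing Implicit Defensive.

Definition hamming_dist (A : finType) (n : nat) (x y : {ffun 'I_n -> A}) : nat :=
  #|[set i | x i != y i]|.

Definition is_min_dist (A : finType) (n : nat) (C : {set {ffun 'I_n -> A}})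
    (d : nat) : Prop :=
  (exists x y : {ffun 'I_n -> A},
     [/\ x \in C, y \in C, x != y & hamming_dist x y = d]) /\
  (forall x y : {ffun 'I_n -> A},
     x \in C -> y \in C -> x != y -> d <= hamming_dist x y).

Definition is_code (A : finType) (n k d : nat) (C : {set {ffun 'I_n -> A}}) : Prop :=
  #|C| = #|A| ^ k /\ is_min_dist C d.

(* The relation d = n - k + 1 is written d + k = n + 1 to avoid the truncated
   subtraction when n < k. *)
Definition is_MDS (A : finType) (n k : nat) (C : {set {ffun 'I_n -> A}}) : Prop :=
  exists2 d : nat, is_code k d C & d + k = n + 1.

Definition has_MDS (A : finType) (k n : nat) : Prop :=
  exists C : {set {ffun 'I_n -> A}}, is_MDS k C.

(* [is_max_MDS_length A k M] says M = M_q(k), where q = #|A|.  It is a relation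
   rather than a function because the maximum need not exist for every k: for
   k = 1 and q > 1 the repetition codes are MDS of every positive length. *)
Definition is_max_MDS_length (A : finType) (k M : nat) : Prop :=
  has_MDS A k M /\ (forall n : nat, has_MDS A k n -> n <= M).

(* Main.v *)
Require Import Defs.
From mathcomp Require Import all_boot all_algebra.
From Stdlib Require Import Classical.
From mathcomp Require Import zify.

(** Write k = q - 2.  An MDS code of length n >= q + 2 and size q^k punctures to
    a code C of length q + 2 and size q^k in which two distinct words agree in
    fewer than k places, so that its minimum distance is at least 5.  Such a C does not
    exist when q is even and 3 divides neither q nor q - 2; both hold when q is
    4 modulo 6.

    Fix z in C and two coordinates i, j, and let W be the set of codewords at
    distance 5 from z that differ from z at both i and j.  The cardinality of W
    is estimated in two ways.

    From below ([weight5_lower]): any k coordinates form an information set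
    ([interpolation]), so each 5-set of coordinates containing i and j, together
    with each value other than z i at i, comes from a word of W.  Hence
    |W| >= C(q, 3) (q - 1).

    From above: let x in W have prescribed values a at i and b at j, and let it
    differ from z at a third coordinate l.  Two such words already agree at i
    and j; were they to differ from z at a common fourth coordinate, they would
    agree with z, hence with each other, at q - 4 more places at least, which
    makes them equal.  So outside {i, j, l} the sets where they differ from z
    are disjoint pairs among q - 1 coordinates, and as q is even there are at
    most (q - 2) / 2 of them ([weight5_at_through]).  Summing over the q choices
    of l counts each word three times, so the number N of words of W with values
    a and b satisfies 6 N <= q (q - 2) ([weight5_at_upper]).

    The average of N over the (q - 1)^2 pairs (a, b) is at least
    C(q, 3) / (q - 1) = q (q - 2) / 6, so N attains its bound q (q - 2) / 6 for
    some pair; but 6 does not divide q (q - 2) ([no_separated_code]). *)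

Set Implicit Arguments.
Unset Strict Implicit.
Unset Printing Implicit Defensive.

(** * Double counting *)

(** All three upper bounds below count the incidences of a relation both ways. *)
Lemma double_counting_leq (T I : finType) (X : {set T}) (J : {set I})
    (r : T -> I -> bool) (m B : nat) :
  (forall x, x \in X -> m <= #|[set l in J | r x l]|) ->
  (forall l, l \in J -> #|[set x in X | r x l]| <= B) ->
  m * #|X| <= #|J| * B.
Proof.
move=> hX hJ.
rewrite mulnC -!sum_nat_const.
apply: (@leq_trans (\sum_(x in X) \sum_(l in J) r x l)).
  apply: leq_sum => x /hX/leq_trans; apply.
  by rewrite -sum1dep_card big_mkcondr /=; apply: leq_sum => l _; case: (r x l).
rewrite exchange_big /=; apply: leq_sum => l /hJ; apply: leq_trans.
by rewrite -sum1dep_card big_mkcondr /=; apply: leq_sum => x _; case: (r x l).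
Qed.

(** * Codes given by an agreement bound *)

Definition agreement (A I : finType) (x y : {ffun I -> A}) : {set I} :=
  [set i | x i == y i].

Definition support_from (A I : finType) (z x : {ffun I -> A}) : {set I} :=
  [set i | x i != z i].

(** In length n this says that the minimum distance is at least n - k + 1.  Put in
    terms of agreements it depends only on k, so it survives puncturing verbatim. *)
Definition separated (A I : finType) (k : nat) (C : {set {ffun I -> A}}) : Prop :=
  forall x y, x \in C -> y \in C -> x != y -> #|agreement x y| < k.

Lemma agreement_supportC (A I : finType) (z x : {ffun I -> A}) :
  agreement x z = ~: support_from z x.
Proof. by apply/setP => l; rewrite !inE negbK. Qed.

(** Restriction to k coordinates is injective on the code by separation, hence
    bijective onto the words on those coordinates by cardinality. *)
Lemma interpolation (A I : finType) (k : nat) (C : {set {ffun I -> A}})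
    (T : {set I}) (f : {ffun I -> A}) :
  separated k C -> #|C| = #|A| ^ k -> #|T| = k ->
  exists2 x, x \in C & {in T, x =1 f}.
Proof.
move=> sepC cardC cardT.
(* Words on T are encoded as words on I that take a default value off T; the
   value of f at a point of T serves as default, as A may be empty when T is. *)
have [i0 i0T|T0] := pickP [in T]; last first.
  have k0 : k = 0 by rewrite -cardT; apply: eq_card0.
  have : 0 < #|C| by rewrite cardC k0.
  by case/card_gt0P => x xC; exists x => // l lT; have := T0 l; rewrite /= lT.
pose a0 := f i0.
pose res (x : {ffun I -> A}) := [ffun l => if l \in T then x l else a0].
have resP x : res x \in pffun_on a0 (mem T) (mem A).
  apply/pffun_onP; split=> [|b _]; last by [].
  by apply/supportP => l lT; rewrite ffunE (negPf lT).
have res_inj : {in C &, injective res}.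
  move=> x y xC yC exy; apply/eqP; apply: contraT => nxy.
  have := sepC x y xC yC nxy; rewrite ltnNge -cardT => /negP[].
  apply/subset_leq_card/subsetP => l lT; rewrite inE.
  by move/ffunP/(_ l): exy; rewrite !ffunE lT => ->.
have eqim : res @: C = [set g in pffun_on a0 (mem T) (mem A)].
  apply/eqP; rewrite eqEcard; apply/andP; split.
    by apply/subsetP => _ /imsetP[x _ ->]; rewrite inE.
  by rewrite card_in_imset // cardsE card_pffun_on cardC cardT.
have : res f \in res @: C by rewrite eqim inE.
case/imsetP => x xC /ffunP e; exists x => // l lT.
by have := e l; rewrite !ffunE lT => ->.
Qed.

(** * Codewords at distance five *)

(** If z is translated to 0, these are the words of weight 5 whose support
    contains i and j. *)
Definition weight5 (A I : finType) (C : {set {ffun I -> A}})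
    (z : {ffun I -> A}) (i j : I) : {set {ffun I -> A}} :=
  [set x in C | [&& #|support_from z x| == 5, x i != z i & x j != z j]].

(** A word is found for each pair (S, a) of a 3-set S avoiding i and j and a value
    a <> z i: interpolate z off j and S, with the value at i changed to a.  This
    prescribes #|A| - 2 values.  The word differs from z, so it cannot agree with
    z at as many as #|A| - 2 places, hence it moves every coordinate of S and j. *)
Lemma weight5_lower (A I : finType) (C : {set {ffun I -> A}})
    (z : {ffun I -> A}) (i j : I) :
  2 < #|A| -> #|I| = #|A| + 2 -> separated (#|A| - 2) C ->
  #|C| = #|A| ^ (#|A| - 2) -> z \in C -> i != j ->
  'C(#|A|, 3) * (#|A| - 1) <= #|weight5 C z i j|.
Proof.
move=> A2 cardI sepC cardC zC nij.
have cardIij : #|~: [set i; j]| = #|A|.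
  by have := cardsC [set i; j]; rewrite cards2 nij cardI; lia.
pose D := setX [set S : {set I} | S \subset ~: [set i; j] & #|S| == 3] [set~ z i].
have cardD : #|D| = 'C(#|A|, 3) * (#|A| - 1).
  by rewrite cardsX cards_draws cardIij cardsC1 subn1.
pose h (x : {ffun I -> A}) := (support_from z x :\: [set i; j], x i).
rewrite -cardD; apply: leq_trans (leq_imset_card h _).
apply/subset_leq_card/subsetP => -[S a]; rewrite !inE /=.
case/andP => /andP[Sij /eqP S3] az.
have [iS jS] : i \notin S /\ j \notin S.
  by split; apply/negP => /(subsetP Sij); rewrite !inE eqxx ?orbT.
pose T := ~: (j |: S).
have cardT : #|T| = #|A| - 2.
  by have := cardsC (j |: S); rewrite cardsU1 jS S3 cardI -/T; lia.
have iT : i \in T by rewrite !inE negb_or nij.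
have [x xC xf] := interpolation [ffun l => if l == i then a else z l] sepC cardC cardT.
have xi : x i = a by rewrite xf // ffunE eqxx.
have nxz : x != z by apply: contraNneq az => <-; rewrite xi.
have sup_sub : support_from z x \subset i |: (j |: S).
  apply/subsetP => l; rewrite inE; apply: contraR.
  rewrite in_setU1 negb_or => /andP[li lS].
  by rewrite xf ?ffunE ?(negPf li) // inE.
have cardU : #|i |: (j |: S)| = 5.
  by rewrite !cardsU1 S3 jS !inE negb_or nij iS.
have sup : support_from z x = i |: (j |: S).
  apply/eqP; rewrite eqEcard sup_sub cardU /=.
  have := sepC x z xC zC nxz; rewrite agreement_supportC.
  by have := cardsC (support_from z x); rewrite cardI; clear -A2; lia.
apply/imsetP; exists x.
  rewrite inE xC sup cardU eqxx /=.
  have := setU11 i (j |: S); rewrite -sup inE => -> /=.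
  by have := setU1r i (setU11 j S); rewrite -sup inE => ->.
rewrite /h xi sup; congr pair; apply/setP => l; rewrite !inE.
by case: eqVneq => [->|_] /=; [apply: negbTE|case: eqVneq => [->|//]; apply: negbTE].
Qed.

Definition weight5_at (A I : finType) (C : {set {ffun I -> A}})
    (z : {ffun I -> A}) (i j : I) (a b : A) : {set {ffun I -> A}} :=
  [set x in weight5 C z i j | (x i == a) && (x j == b)].

(** Supports meeting in 4 places have a union of size at most 6, outside of which
    both words coincide with z; with i and j this gives at least
    (#|A| + 2 - 6) + 2 = #|A| - 2 agreements. *)
Lemma weight5_at_eq (A I : finType) (C : {set {ffun I -> A}})
    (z : {ffun I -> A}) (i j : I) (a b : A) (x y : {ffun I -> A}) :
  #|I| = #|A| + 2 -> separated (#|A| - 2) C -> i != j ->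
  x \in weight5_at C z i j a b -> y \in weight5_at C z i j a b ->
  3 < #|support_from z x :&: support_from z y| -> x = y.
Proof.
move=> cardI sepC nij; rewrite !inE.
case/andP => /and4P[xC /eqP sx xi xj] /andP[/eqP xa /eqP xb].
case/andP => /and4P[yC /eqP sy yi yj] /andP[/eqP ya /eqP yb] big.
apply/eqP; apply: contraT => nxy.
have := sepC x y xC yC nxy; rewrite ltnNge => /negP[].
pose V := support_from z x :|: support_from z y.
have V6 : #|V| <= 6 by rewrite cardsU sx sy; clear -big; lia.
have dis : [disjoint [set i; j] & ~: V].
  rewrite -subsets_disjoint; apply/subsetP => l.
  by rewrite !inE => /orP[] /eqP ->; rewrite ?xi ?xj.
have sub : [set i; j] :|: ~: V \subset agreement x y.
  apply/subsetP => l; rewrite !inE negb_or !negbK.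
  case/orP => [/orP[] /eqP ->|/andP[/eqP -> /eqP ->] //]; first by rewrite xa ya.
  by rewrite xb yb.
apply: leq_trans (subset_leq_card sub).
rewrite cardsU (disjoint_setI0 dis) cards0 cards2 nij.
by have := cardsC V; rewrite cardI; clear -V6; lia.
Qed.

(** Outside i, j and l the supports are pairwise disjoint 2-sets in a set of
    #|A| - 1 coordinates.  Since #|A| - 1 is odd, they cannot cover all of it. *)
Lemma weight5_at_through (A I : finType) (C : {set {ffun I -> A}})
    (z : {ffun I -> A}) (i j l : I) (a b : A) :
  ~~ odd #|A| -> #|I| = #|A| + 2 -> separated (#|A| - 2) C ->
  i != j -> l \notin [set i; j] ->
  #|[set x in weight5_at C z i j a b | x l != z l]| <= #|A|./2 - 1.
Proof.
move=> Aev cardI sepC nij lij.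
have cardJ : #|~: (l |: [set i; j])| = #|A| - 1.
  have := cardsC (l |: [set i; j]).
  by rewrite cardsU1 lij cards2 nij cardI; lia.
set X := [set x in _ | _].
suff : 2 * #|X| <= (#|A| - 1) * 1 by lia.
rewrite -cardJ.
apply: (double_counting_leq (r := fun (x : {ffun I -> A}) m => x m != z m)).
  move=> x; rewrite !inE -andbA => /andP[/and4P[_ /eqP sx xi xj] /andP[_ xl]].
  have -> : [set m in ~: (l |: [set i; j]) | x m != z m] =
            support_from z x :\: (l |: [set i; j]).
    by apply/setP => m; rewrite !inE.
  have sub : l |: [set i; j] \subset support_from z x.
    by apply/subsetP => m; rewrite !inE => /or3P[] /eqP ->.
  by rewrite cardsD (setIidPr sub) sx cardsU1 lij cards2 nij.
move=> m; rewrite inE => mJ; apply/card_le1_eqP => x y.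
rewrite !inE => /andP[/andP[xW xl] xm] /andP[/andP[yW yl] ym].
apply: (@weight5_at_eq _ _ C z i j a b) => //; rewrite ?inE //.
move: xW yW => /andP[/and4P[_ _ xi xj] _] /andP[/and4P[_ _ yi yj] _].
have sub : m |: (l |: [set i; j]) \subset support_from z y :&: support_from z x.
  by apply/subsetP => t; rewrite !inE => /or4P[] /eqP ->; apply/andP.
by apply: leq_trans (subset_leq_card sub); rewrite cardsU1 mJ cardsU1 lij cards2 nij.
Qed.

(** Each word has three coordinates l in its support besides i and j, and
    [weight5_at_through] bounds the words through each of the #|A| choices of l. *)
Lemma weight5_at_upper (A I : finType) (C : {set {ffun I -> A}})
    (z : {ffun I -> A}) (i j : I) (a b : A) :
  ~~ odd #|A| -> #|I| = #|A| + 2 -> separated (#|A| - 2) C -> i != j ->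
  3 * #|weight5_at C z i j a b| <= #|A| * (#|A|./2 - 1).
Proof.
move=> Aev cardI sepC nij.
have cardJ : #|~: [set i; j]| = #|A|.
  by have := cardsC [set i; j]; rewrite cards2 nij cardI; lia.
rewrite -[X in _ <= X * _]cardJ.
apply: (double_counting_leq (r := fun (x : {ffun I -> A}) m => x m != z m)) => [x|l lij].
  rewrite !inE => /andP[/and4P[_ /eqP sx xi xj] _].
  have -> : [set m in ~: [set i; j] | x m != z m] = support_from z x :\: [set i; j].
    by apply/setP => m; rewrite !inE.
  have sub : [set i; j] \subset support_from z x.
    by apply/subsetP => m; rewrite !inE => /orP[] /eqP ->.
  by rewrite cardsD (setIidPr sub) sx cards2 nij.
by apply: weight5_at_through => //; rewrite inE in lij.
Qed.

Lemma weight5_upper (A I : finType) (C : {set {ffun I -> A}})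
    (z : {ffun I -> A}) (i j : I) (B : nat) :
  (forall a b, #|weight5_at C z i j a b| <= B) ->
  #|weight5 C z i j| <= (#|A| - 1) * (#|A| - 1) * B.
Proof.
move=> hB.
have cardJ : #|setX [set~ z i] [set~ z j]| = (#|A| - 1) * (#|A| - 1).
  by rewrite cardsX !cardsC1 subn1.
rewrite -[leqLHS]mul1n -cardJ.
pose r (x : {ffun I -> A}) (p : A * A) := (x i == p.1) && (x j == p.2).
apply: (double_counting_leq (r := r)) => [x|[a b] _]; last exact: hB.
rewrite inE => /and4P[_ _ xi xj]; apply/card_gt0P; exists (x i, x j).
by rewrite !inE /r !eqxx xi xj.
Qed.

(** The two bounds on [weight5] leave no slack: after division by (#|A| - 1)^2
    they force the integer bound on [weight5_at] to reach q (q - 2) / 6. *)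
Lemma no_separated_code (A I : finType) (C : {set {ffun I -> A}}) :
  #|A| = 4 %[mod 6] -> #|I| = #|A| + 2 -> separated (#|A| - 2) C ->
  #|C| <> #|A| ^ (#|A| - 2).
Proof.
move=> A6 cardI sepC cardC.
have A4 : 3 < #|A| by lia.
have Aev : ~~ odd #|A| by lia.
have [z zC] : exists z, z \in C.
  by apply/card_gt0P; rewrite cardC expn_gt0; lia.
have [i [j [_ _ nij]]] : exists i j, [/\ i \in I, j \in I & i != j].
  by apply/card_gt1P; rewrite cardI; lia.
set q := #|A| in A6 cardI sepC cardC A4 Aev.
pose B := (q * (q./2 - 1)) %/ 3.
have hB a b : #|weight5_at C z i j a b| <= B.
  by rewrite leq_divRL // mulnC weight5_at_upper.
have low : 'C(q, 3) * (q - 1) <= #|weight5 C z i j|.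
  by apply: weight5_lower => //; apply: ltnW.
have bin3 : 'C(q, 3) * 6 = q * (q - 1) * (q - 2).
  by rewrite (bin_ffact q 3) !ffactnSr ffactn0 mul1n subn0.
have nB : B * 6 < q * (q - 2).
  (* With q = 6 t + 4 the product q * (q / 2 - 1) is 1 modulo 3, so that the
     rounding in B makes the inequality strict. *)
  have [t qt] : exists t, q = 6 * t + 4 by exists (q %/ 6); lia.
  rewrite /B qt; have -> : (6 * t + 4)./2 - 1 = 3 * t + 1 by lia.
  have -> : (6 * t + 4) * (3 * t + 1) = (6 * t * t + 6 * t + 1) * 3 + 1 by nia.
  by rewrite divnMDl //; nia.
have := leq_trans low (weight5_upper hB); rewrite -/q => le.
have pos : 0 < (q - 1) * (q - 1) by rewrite muln_gt0; clear -A4; lia.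
have e : (q - 1) * (q - 1) * (q * (q - 2)) = 'C(q, 3) * (q - 1) * 6.
  by rewrite [RHS]mulnAC bin3; move: (q - 1) (q - 2) => u v; clear; lia.
have : (q - 1) * (q - 1) * (q * (q - 2)) <= (q - 1) * (q - 1) * (B * 6).
  by rewrite e mulnA leq_mul2r le.
by rewrite leq_pmul2l // leqNgt nB.
Qed.

(** * MDS codes and their maximal length *)

Lemma MDS_separated (A : finType) (n k : nat) (C : {set {ffun 'I_n -> A}}) :
  is_MDS k C -> #|C| = #|A| ^ k /\ separated k C.
Proof.
case=> d [cardC [_ dmin]] dk; split=> // x y xC yC nxy.
have := dmin x y xC yC nxy; rewrite agreement_supportC /hamming_dist.
rewrite -/(support_from y x) -/(support_from x y).
have -> : support_from y x = support_from x y.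
  by apply/setP => l; rewrite !inE eq_sym.
by have := cardsC (support_from x y); rewrite card_ord; lia.
Qed.

(** Puncturing cannot create agreements, and it stays injective on the code as
    long as k coordinates remain. *)
Lemma separated_puncture (A I J : finType) (k : nat) (C : {set {ffun I -> A}})
    (h : J -> I) :
  injective h -> k <= #|J| -> separated k C ->
  exists2 C' : {set {ffun J -> A}}, #|C'| = #|C| & separated k C'.
Proof.
move=> h_inj kJ sepC; pose p (x : {ffun I -> A}) := [ffun l => x (h l)].
have agr x y : #|agreement (p x) (p y)| <= #|agreement x y|.
  rewrite -(card_imset _ h_inj); apply/subset_leq_card/subsetP => _ /imsetP[l lxy ->].
  by move: lxy; rewrite !inE !ffunE.
have p_inj : {in C &, injective p}.
  move=> x y xC yC exy; apply/eqP; apply: contraT => nxy.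
  have := leq_ltn_trans (agr x y) (sepC x y xC yC nxy).
  have -> : agreement (p x) (p y) = setT by apply/setP => l; rewrite !inE exy eqxx.
  by rewrite cardsT ltnNge kJ.
exists (p @: C); first exact: card_in_imset.
move=> _ _ /imsetP[x xC ->] /imsetP[y yC ->] nxy.
apply: leq_ltn_trans (agr x y) (sepC x y xC yC _).
by apply: contra nxy => /eqP ->.
Qed.

(** The whole space A^n is an MDS code with d = 1, so that some length is
    attained and the maximum exists once lengths are bounded. *)
Lemma has_MDS_full (A : finType) (n : nat) : 0 < n -> 1 < #|A| -> has_MDS A n n.
Proof.
case: n => // n _ A1; exists setT; exists 1; last by rewrite addnC.
split; first by rewrite cardsT card_ffun card_ord.
have posdist (x y : {ffun 'I_n.+1 -> A}) : x != y -> 0 < hamming_dist x y.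
  move=> nxy; rewrite card_gt0; apply: contra nxy => /eqP/setP e.
  by apply/eqP/ffunP => l; have := e l; rewrite !inE => /negbFE/eqP.
split; last by move=> x y _ _ /posdist.
have /card_gt1P[a [b [_ _ nab]]] := A1.
pose x : {ffun 'I_n.+1 -> A} := [ffun=> a].
pose y : {ffun 'I_n.+1 -> A} := [ffun l => if l == ord0 then b else a].
have nxy : x != y.
  by apply: contraNneq nab => /ffunP/(_ ord0); rewrite !ffunE eqxx => ->.
exists x, y; split; rewrite ?in_setT //; apply/eqP; rewrite eqn_leq posdist // andbT.
rewrite -(cards1 (ord0 : 'I_n.+1)); apply/subset_leq_card/subsetP => l.
by rewrite !inE !ffunE; case: ifP => // _; rewrite eqxx.
Qed.

Lemma bounded_max (P : nat -> Prop) (b : nat) :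
  (exists n, P n) -> (forall n, P n -> n <= b) ->
  exists M, [/\ P M, forall n, P n -> n <= M & M <= b].
Proof.
move=> exP; elim: b => [|b IHb] bP.
  have [n Pn] := exP; have n0 := bP n Pn; exists n; split=> // m /bP.
  by move=> m0; apply: leq_trans m0 _.
have [Pb|nPb] := classic (P b.+1); first by exists b.+1.
have [|M [PM maxM Mb]] := IHb; last by exists M; split=> //; apply: leqW.
move=> n Pn; have := bP n Pn; rewrite leq_eqVlt => /predU1P[e|//].
by case: nPb; rewrite -e.
Qed.

Theorem corollary2p2p1 (q : nat) (q_gt0 : 0 < q) (q_mod6 : q = 4 %[mod 6])
    (A : finZmodType) (cardA : #|A| = q) :
  exists M : nat, is_max_MDS_length A (q - 2) M /\ M <= q + 1.
Proof.
have q4 : 3 < q by lia.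
have bounded n : has_MDS A (q - 2) n -> n <= q + 1.
  case=> C /MDS_separated[cardC sepC]; rewrite leqNgt; apply/negP => qn.
  have le : q + 2 <= n by lia.
  have kle : q - 2 <= #|'I_(q + 2)| by rewrite card_ord; lia.
  have inj : injective (widen_ord le) by move=> i j [] /ord_inj.
  have [C' cardC' sepC'] := separated_puncture inj kle sepC.
  apply: (@no_separated_code A 'I_(q + 2) C'); rewrite ?card_ord ?cardA //.
  by rewrite cardC' cardC cardA.
have [|M [PM maxM Mq]] := bounded_max _ bounded; last by exists M.
by exists (q - 2); apply: has_MDS_full; rewrite ?cardA; lia.
Qed.
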